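(* Let $\chi:\mathbb{R}\to\mathbb{R}$ be a strictly positive kernel satisfying conditions $(\chi1)$ and $(\chi3)$–$(\chi5)$ (listed in the context). Let $f,g:[0,1]\to\mathbb{R}^{+}$ be two bounded functions, both bounded below by strictly positive constants. Suppose there exist $a,b\in[0,1]$, with $0<a<b<1$, such that $f(x)=g(x)$ for all $x\in[a,b]$. Then, for any $c,d\in[a,b]$ with $a<c<d<b$, there exists $\overline{n}\in\mathbb{N}$, depending only on $a,b,c,d,f,g$ and $\chi$, such that $$S_{n}^{\chi}(f)(x)=S_{n}^{\chi}(g)(x)$$ for all $x\in[c,d]$ and all $n\ge\overline{n}$.
   Context: $\mathbb{R}^{+}$ denotes the strictly positive reals. The symbol $\bigvee_{k\in J}A_k$ denotes $\sup\{A_k: k\in J\}$ (a maximum when $J$ is finite). Kernel conditions: $\chi:\mathbb{R}\to\mathbb{R}$ is bounded and measurable, strictly positive means $\chi(x)>0$ for all $x\in\mathbb{R}$, and $(\chi1)$ for some $\beta>0$, $\sup_{y\in\mathbb{R}}|\chi(y)|\,|y|^{\beta}<+\infty$; $(\chi3)$ $\chi$ is continuous on $\mathbb{R}$, $\chi(x)\ge 0$ for every $x\in\mathbb{R}$, and $\lim_{|x|\to+\infty}\chi(x)=0$; $(\chi4)$ $\chi$ is even; $(\chi5)$ $\chi(x)$ is non-decreasing for $x<0$ and non-increasing for $x\ge 0$. For bounded $f:[0,1]\to\mathbb{R}$ and $n\in\mathbb{N}$, $n\ge1$, the (truncated) max-product generalized sampling operator is $$S_{n}^{\chi}(f)(x)=\frac{\bigvee_{k=0}^{n}f\left(\frac{k}{n}\right)\chi(nx-k)}{\bigvee_{k=0}^{n}\chi(nx-k)},\quad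 x\in[0,1].$$ *)

(* Defs.v *)
From mathcomp Require Export all_boot all_order all_algebra.
From mathcomp Require Export all_classical all_reals all_analysis.
Export Order.TTheory GRing.Theory Num.Theory numFieldNormedType.Exports.

Set Implicit Arguments.
Unset Strict Implicit.
Unset Printing Implicit Defensive.

Local Open Scope classical_set_scope.
Local Open Scope ring_scope.

Definition kernel_chi1 (R : realType) (chi : R -> R) : Prop :=
  exists2 beta : R, 0 < beta &
    (ereal_sup [set (`|chi y| * `|y| `^ beta)%:E | y in [set: R]] < +oo)%E.

Definition kernel_chi3 (R : realType) (chi : R -> R) : Prop :=
  [/\ continuous chi,
      (forall x : R, 0 <= chi x),
      chi x @[x --> +oo] --> (0 : R)
    & chi x @[x --> -oo] --> (0 : R)].

Definition kernel_chi4 (R : realType) (chi : R -> R) : Prop :=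
  forall x : R, chi (- x) = chi x.

Definition kernel_chi5 (R : realType) (chi : R -> R) : Prop :=
  (forall x y : R, x <= y -> y < 0 -> chi x <= chi y) /\
  (forall x y : R, 0 <= x -> x <= y -> chi y <= chi x).

Definition bigvee (R : realType) (J : set nat) (A : nat -> R) : R :=
  sup [set A k | k in J].

(* A function on [0, 1] is represented by a total function on R; only its
   values at the nodes k / n, which lie in [0, 1] for 0 < n, are used. *)
Definition maxprod_sampling (R : realType) (chi : R -> R) (n : nat)
    (f : R -> R) (x : R) : R :=
  bigvee [set k : nat | (k <= n)%N]
    (fun k => f (k%:R / n%:R) * chi (n%:R * x - k%:R)) /
  bigvee [set k : nat | (k <= n)%N] (fun k => chi (n%:R * x - k%:R)).

(* Main.v *)
Require Import Defs.
From mathcomp Require Import lra.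

Local Open Scope classical_set_scope.
Local Open Scope ring_scope.

(** The operator is localized: at a point x of [c, d], and for n large, only the
    nodes k / n of [a, b] can realize the supremum in the numerator.

    The node j / n with j = floor (n x) lies within 1 / n of x, hence in [a, b],
    and contributes at least m * chi 1, where m > 0 is a lower bound of f. A
    node outside [a, b] is at distance at least delta = min (c - a) (b - d)
    from x, so it contributes at most M * chi (n delta), where M is an upper
    bound of f. Since chi vanishes at infinity, the latter is eventually
    smaller, uniformly in x ([node_dominated_in_itv]).

    So each term of the numerator for f is bounded by a term of the same
    numerator whose node lies in [a, b], which is also a term of the numerator
    for g. Exchanging f and g, the two suprema bound each other; the
    denominators are the same. *)

Lemma bigvee_le (R : realType) (J : set nat) (A B : nat -> R) :
  J !=set0 -> has_ubound [set B k | k in J] ->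
  (forall k, J k -> exists2 j, J j & A k <= B j) ->
  bigvee J A <= bigvee J B.
Proof.
move=> [k0 Jk0] ubB AB; apply: ge_sup; first by exists (A k0), k0.
move=> _ [k Jk <-]; have [j Jj /le_trans] := AB k Jk; apply.
by apply: ub_le_sup => //; exists j.
Qed.

Lemma has_ubound_initial (R : realType) (A : nat -> R) (n : nat) :
  has_ubound [set A k | k in [set k : nat | (k <= n)%N]].
Proof.
exists (\big[Num.max/0]_(k < n.+1) A k) => _ [k kn <-].
by apply: (le_bigmax _ _ (Ordinal (kn : (k < n.+1)%N))).
Qed.

Lemma kernel_le_norm (R : realType) (chi : R -> R) (x y : R) :
  kernel_chi4 chi -> kernel_chi5 chi -> `|x| <= `|y| -> chi y <= chi x.
Proof.
move=> chi_even [_ chi_noninc] xy.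
have chi_norm z : chi `|z| = chi z by case: (ger0P z).
by rewrite -(chi_norm x) -(chi_norm y); apply: chi_noninc.
Qed.

Lemma node_itv01 (R : realType) (n k : nat) :
  (k <= n)%N -> 0 <= (k%:R / n%:R : R) <= 1.
Proof.
move=> kn; apply/andP; split; first by rewrite divr_ge0.
have [->|n_gt0] := posnP n; first by rewrite invr0 mulr0 ler01.
by rewrite ler_pdivrMr ?ltr0n// mul1r ler_nat.
Qed.

(** This is where the interval [c, d] and the decay of the kernel enter. A node
    k / n already in [a, b] dominates itself; any other one is too far from x to
    compete with the node just below x. The rank of n must not depend on x,
    which is why the quantifier on x is inside the filter. *)
Lemma node_dominated_in_itv (R : realType) (chi f : R -> R) (a b c d : R) :
  (forall x, 0 < chi x) -> kernel_chi4 chi -> kernel_chi5 chi ->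
  chi x @[x --> +oo] --> (0 : R) ->
  [bounded f x | x in [set x : R | 0 <= x <= 1]] ->
  (exists2 m : R, 0 < m & forall x : R, 0 <= x <= 1 -> m <= f x) ->
  0 <= a -> b <= 1 -> a < c -> d < b ->
  \forall n \near \oo, forall (x : R) (k : nat), c <= x <= d -> (k <= n)%N ->
    exists j : nat, [/\ (j <= n)%N, a <= j%:R / n%:R <= b &
      f (k%:R / n%:R) * chi (n%:R * x - k%:R)
        <= f (j%:R / n%:R) * chi (n%:R * x - j%:R)].
Proof.
move=> chi_pos chi_even chi5 chi_cvg0 f_bounded [m m_gt0 mf] a_ge0 b_le1 ac db.
have [M M_gt0 fM] := pinfty_ex_gt0 f_bounded.
pose delta := Num.min (c - a) (b - d).
have delta_gt0 : 0 < delta by rewrite lt_min !subr_gt0 ac db.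
have [T [_ chiT]] : \forall t \near +oo, chi t < m * chi 1 / M.
  by apply: (cvgr_lt _ chi_cvg0); rewrite !divr_gt0 ?mulr_gt0.
have large (B : R) : \forall n \near \oo, B < n%:R * delta.
  by near=> n; rewrite -ltr_pdivrMr//; near: n; exact: nbhs_infty_gtr.
near=> n => x k /andP[cx xd] kn.
have [ka|kb] := boolP (a <= k%:R / n%:R <= b); first by exists k.
have n_gt0 : 0 < n%:R :> R by rewrite ltr0n; near: n; exact: nbhs_infty_gt.
(* With n delta > 1, the spacing 1 / n is less than c - a, so the node just
   below x is still above a. *)
have n_delta1 : 1 < n%:R * delta by near: n.
have n_deltaT : T < n%:R * delta by near: n.
have [delta_ca delta_bd] : delta <= c - a /\ delta <= b - d.
  by rewrite !ge_min !lexx orbT.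
have nx_ge0 : 0 <= n%:R * x by rewrite mulr_ge0 ?ltW//; lra.
have /andP[j_le j_gt] := truncn_itv nx_ge0.
set j := Num.truncn _ in j_le j_gt; rewrite -natr1 in j_gt.
have n_delta_ca : n%:R * delta <= n%:R * c - n%:R * a.
  by rewrite -mulrBr ler_pM2l.
have n_delta_bd : n%:R * delta <= n%:R * b - n%:R * d.
  by rewrite -mulrBr ler_pM2l.
have ncx : n%:R * c <= n%:R * x by rewrite ler_pM2l.
have nxd : n%:R * x <= n%:R * d by rewrite ler_pM2l.
have jn : (j <= n)%N.
  have nb : n%:R * b <= n%:R * 1 by rewrite ler_pM2l.
  by rewrite -(ler_nat R); lra.
exists j; split => //.
  by rewrite ler_pdivlMr// ler_pdivrMr// ![_ * n%:R]mulrC; apply/andP; split; lra.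
have far : n%:R * delta <= `|n%:R * x - k%:R|.
  move: kb; rewrite ler_pdivlMr// ler_pdivrMr// ![_ * n%:R]mulrC.
  rewrite negb_and -!ltNge ler_normr => /orP[ka|kb]; apply/orP.
    by left; lra.
  by right; lra.
have chi_far : M * chi (n%:R * x - k%:R) <= m * chi 1.
  rewrite mulrC -ler_pdivlMr//; apply: le_trans (ltW (chiT _ n_deltaT)).
  apply: kernel_le_norm => //; rewrite ger0_norm//.
  by rewrite mulr_ge0 ?ltW.
have chi_near : chi 1 <= chi (n%:R * x - j%:R).
  by apply: kernel_le_norm => //; rewrite normr1 ler_norml; lra.
apply: (@le_trans _ _ (M * chi (n%:R * x - k%:R))).
  rewrite ler_pM2r//; apply: le_trans (ler_norm _) _.
  by apply: fM; exact: node_itv01.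
apply: le_trans chi_far _; apply: ler_pM => //; try exact: ltW.
by apply: mf; exact: node_itv01.
Unshelve. all: by end_near. Qed.

Theorem theorem5p1 (R : realType) (chi : R -> R)
  (chi_bounded : [bounded chi x | x in [set: R]])
  (chi_measurable : measurable_fun [set: R] chi)
  (chi_pos : forall x : R, 0 < chi x)
  (chi1 : kernel_chi1 chi) (chi3 : kernel_chi3 chi)
  (chi4 : kernel_chi4 chi) (chi5 : kernel_chi5 chi)
  (f g : R -> R)
  (f_pos : forall x : R, 0 <= x <= 1 -> 0 < f x)
  (g_pos : forall x : R, 0 <= x <= 1 -> 0 < g x)
  (f_bounded : [bounded f x | x in [set x : R | 0 <= x <= 1]])
  (g_bounded : [bounded g x | x in [set x : R | 0 <= x <= 1]])
  (f_lower : exists2 m : R, 0 < m & forall x : R, 0 <= x <= 1 -> m <= f x)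
  (g_lower : exists2 m : R, 0 < m & forall x : R, 0 <= x <= 1 -> m <= g x)
  (a b : R) (a_gt0 : 0 < a) (a_lt_b : a < b) (b_lt1 : b < 1)
  (fg_eq : forall x : R, a <= x <= b -> f x = g x)
  (c d : R) (a_lt_c : a < c) (c_lt_d : c < d) (d_lt_b : d < b) :
  exists2 nbar : nat, (1 <= nbar)%N &
    forall (x : R) (n : nat), c <= x <= d -> (nbar <= n)%N ->
      maxprod_sampling chi n f x = maxprod_sampling chi n g x.
Proof.
have [_ _ chi_cvg0 _] := chi3.
have localize h :=
  @node_dominated_in_itv R chi h a b c d chi_pos chi4 chi5 chi_cvg0.
(* The two numerators are compared in both directions, so this is for any pair
   of functions; since dominating nodes lie in [a, b], agreement there is enough
   to replace h1 by h2 in the dominating term. *)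
have numerator_le (h1 h2 : R -> R) (x : R) (n : nat) :
    (forall y, a <= y <= b -> h1 y = h2 y) ->
    (forall k : nat, (k <= n)%N ->
      exists j : nat, [/\ (j <= n)%N, a <= j%:R / n%:R <= b &
        h1 (k%:R / n%:R) * chi (n%:R * x - k%:R)
          <= h1 (j%:R / n%:R) * chi (n%:R * x - j%:R)]) ->
    bigvee [set k : nat | (k <= n)%N]
      (fun k => h1 (k%:R / n%:R) * chi (n%:R * x - k%:R))
    <= bigvee [set k : nat | (k <= n)%N]
      (fun k => h2 (k%:R / n%:R) * chi (n%:R * x - k%:R)).
  move=> h12 dominated; apply: bigvee_le; first by exists 0%N.
    exact: has_ubound_initial.
  move=> k /dominated[j [jn jab le_kj]]; exists j => //.
  by rewrite -h12.
have dominated_f :=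
  localize f f_bounded f_lower (ltW a_gt0) (ltW b_lt1) a_lt_c d_lt_b.
have dominated_g :=
  localize g g_bounded g_lower (ltW a_gt0) (ltW b_lt1) a_lt_c d_lt_b.
have [N _ dominated] := filterI dominated_f dominated_g.
exists N.+1 => // x n cxd /ltnW/dominated[dom_f dom_g].
congr (_ / _); apply/le_anti/andP; split; apply: numerator_le.
- exact: fg_eq.
- by move=> k; exact: dom_f.
- by move=> y /fg_eq.
- by move=> k; exact: dom_g.
Qed.
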